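(* Assume $g$ is separable, $g(x)=\sum_{j=1}^dg_j(x^{(j)})$, and $\mu_g$-strongly convex with $\mu_g>0$. Let $\pi^{(j)}=|I(j)|/n$. Run the sparse PURE-CD algorithm (described in the context) with $$\tilde\tau_0=\min\left\{\frac1n,\frac{\mu_g}{n\max_i\|A_i\|}\right\},\qquad \sigma_0=\frac1{\max_i\|A_i\|},\qquad \sigma_k^{(i)}=\sigma_k\ \text{ for all } i,$$ $$\tilde\tau_{k+1}=\frac{\tilde\tau_k}{\sqrt{1+\tilde\tau_k}},\quad \tau_k^{(j)}=\frac{\tilde\tau_k}{\mu_g\pi^{(j)}-\mu_g(1-\pi^{(j)})\tilde\tau_k},\quad \sigma_{k+1}=\sigma_k\sqrt{1+\tilde\tau_k},\quad \theta_k^{(j)}=\frac{\pi^{(j)}n}{1+\mu_g\tau_k^{(j)}}.$$ Then $\mathbb{E}\left[\|x_K-x_\star\|^2\right]\le\varepsilon$ for $K$ satisfying $$K\ge\frac{\sqrt{D_\star}}{\sqrt\varepsilon}\,3n\max\left(1,\frac{\max_i\|A_i\|}{\mu_g}\right),$$ with expected complexity $$O\left(\mathrm{nnz}(A)\left(1+\frac{\sqrt{D_\star}}{\sqrt\varepsilon}\max\left(1,\frac{\max_i\|A_i\|}{\mu_g}\right)\right)\right).$$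
   Context: Problem: $\min_{x\in\mathbb{R}^d}\max_{y\in\mathbb{R}^n} L(x,y)$ with $L(x,y)=\langle Ax,y\rangle-h^*(y)+g(x)$, where $A\in\mathbb{R}^{n\times d}$ has rows $A_1,\dots,A_n$, $g:\mathbb{R}^d\to(-\infty,+\infty]$ and $h^*:\mathbb{R}^n\to(-\infty,+\infty]$ are proper convex lower semicontinuous, and $h^*(y)=\sum_{i=1}^n h_i^*(y^{(i)})$ is separable (superscript $(i)$ denotes the $i$-th coordinate). It is assumed that a saddle point $(x_\star,y_\star)$ exists: $L(x,y_\star)\ge L(x_\star,y_\star)\ge L(x_\star,y)$ for all $x,y$; $x_\star$ denotes the primal part of a saddle point. A convex $f$ is $\mu$-strongly convex if $f(u)\ge f(v)+\langle q,u-v\rangle+\frac\mu2\|u-v\|^2$ for all $u,v$ and $q\in\partial f(v)$. Notation: $\|\cdot\|$ is the Euclidean norm; $\mathrm{nnz}(A)$ is the number of nonzero entries of $A$; $J(i)=\{j:A_{i,j}\ne0\}$, $I(j)=\{i:A_{i,j}\neq0\}$. $\mathrm{prox}_{\tau,f}(x)=\arg\min_u\{f(u)+\frac1{2\tau}|u-x|^2\}$ for scalar $\tau>0$. $D_\star=\min(\|x_\star-x_0\|^2+\|y_\star-y_0\|^2)$ over all saddle points $(x_\star,y_\star)$. Sparse PURE-CD algorithm: start from $x_0\in\mathrm{dom}\,g$, $y_0\in\mathrm{dom}\,h^*$. Given step sizes $\tau_k^{(j)},\sigma_k^{(i)},\theta_k^{(j)}$, for $k=0,1,\dots$: 1. pick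 $i_k\in\{1,\dots,n\}$ uniformly at random, independently of the past; 2. $\bar x_{k+1}^{(j)}=\mathrm{prox}_{\tau_k^{(j)},g_j}\big(x_k^{(j)}-\tau_k^{(j)}(A^\top y_k)^{(j)}\big)$ for $j\in J(i_k)$; 3. $y_{k+1}^{(i_k)}=\mathrm{prox}_{\sigma_k^{(i_k)},h_{i_k}^*}\big(y_k^{(i_k)}+\sigma_k^{(i_k)}A_{i_k}\bar x_{k+1}\big)$ (only the coordinates of $\bar x_{k+1}$ in $J(i_k)$ matter), and $y_{k+1}^{(i)}=y_k^{(i)}$ for $i\ne i_k$; 4. $x_{k+1}^{(j)}=\bar x_{k+1}^{(j)}-\tau_k^{(j)}\theta_k^{(j)}A_{i_k,j}(y_{k+1}^{(i_k)}-y_k^{(i_k)})$ for $j\in J(i_k)$, and $x_{k+1}^{(j)}=x_k^{(j)}$ for $j\notin J(i_k)$. Complexity convention: the expected complexity is the number of iterations $K$ multiplied by the expected cost per iteration $\frac1n\mathrm{nnz}(A)$ (iteration $k$ costs $O(|J(i_k)|)$), plus $O(\mathrm{nnz}(A))$ for computing $A^\top y_0$.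
   Formalization: It is additionally assumed that every column of A has a nonzero entry (π^(j) > 0 for all j); for a zero column θ_k^(j) is 0/0, and the coordinate x^(j) is never updated, so the claimed bound fails. *)

(* Defs.v *)
From HB Require Import structures.
From mathcomp Require Import all_boot all_order all_algebra.
From mathcomp Require Import all_classical all_reals all_analysis.
Set Implicit Arguments.
Unset Strict Implicit.
Unset Printing Implicit Defensive.
Import Order.TTheory GRing.Theory Num.Theory.
Import numFieldNormedType.Exports.
Local Open Scope classical_set_scope.
Local Open Scope ring_scope.

Section Euclidean.
Context {R : realType}.

Definition dotv m (u v : 'cV[R]_m) : R := \sum_(i < m) u i 0 * v i 0.

(* The library norm on matrices is the max norm, not the Euclidean one. *)
Definition normv m (u : 'cV[R]_m) : R := Num.sqrt (dotv u u).

End Euclidean.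

Section ConvexAnalysis.
Context {R : realType}.
Local Open Scope ereal_scope.

Definition proper_fun m (f : 'cV[R]_m -> \bar R) : Prop :=
  (forall x, f x != -oo) /\ exists x, f x < +oo.

Definition convex_ereal m (f : 'cV[R]_m -> \bar R) : Prop :=
  forall (x y : 'cV[R]_m) (t : R), (0 <= t <= 1)%R ->
    f (t *: x + (1 - t) *: y)%R <= t%:E * f x + (1 - t)%:E * f y.

Definition separable m (f : 'cV[R]_m -> \bar R) (f_ : 'I_m -> R -> \bar R) :
    Prop :=
  forall x, f x = \sum_(j < m) f_ j (x j 0%R).

(* For proper f, subdiff f v is empty as soon as f v = +oo. *)
Definition subdiff m (f : 'cV[R]_m -> \bar R) (v : 'cV[R]_m) : set 'cV[R]_m :=
  [set q | forall u, f v + (dotv q (u - v)%R)%:E <= f u].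

Definition strongly_convex m (mu : R) (f : 'cV[R]_m -> \bar R) : Prop :=
  forall u v q, q \in subdiff f v ->
    f v + (dotv q (u - v)%R)%:E + (mu / 2 * normv (u - v)%R ^+ 2)%:E <= f u.

Definition prox_argmin (tau : R) (f : R -> \bar R) (x : R) : set R :=
  [set p | forall u, f p + ((p - x) ^+ 2 / (2 * tau))%:E
                       <= f u + ((u - x) ^+ 2 / (2 * tau))%:E].

(* The default value x is irrelevant for 0 < tau and f proper, convex, lower
   semicontinuous: the minimizer then exists and is unique. *)
Definition prox (tau : R) (f : R -> \bar R) (x : R) : R :=
  xget x (prox_argmin tau f x).

End ConvexAnalysis.

Section SaddlePoints.
Context {R : realType} {n d : nat}.
Variables (A : 'M[R]_(n, d)) (g : 'cV[R]_d -> \bar R) (hs : 'cV[R]_n -> \bar R).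
Local Open Scope ereal_scope.

(* When g x = hs y = +oo the sum is -oo by library convention; for proper g and
   hs this does not affect which pairs are saddle points: they all lie in
   dom g * dom hs. *)
Definition lagrangian (x : 'cV[R]_d) (y : 'cV[R]_n) : \bar R :=
  (dotv (A *m x) y)%:E - hs y + g x.

Definition saddle_point (xs : 'cV[R]_d) (ys : 'cV[R]_n) : Prop :=
  forall x y, lagrangian xs y <= lagrangian xs ys <= lagrangian x ys.

(* The infimum is attained, since the set of saddle points is closed. *)
Definition Dstar (x0 : 'cV[R]_d) (y0 : 'cV[R]_n) : R :=
  inf [set r | exists xs ys, saddle_point xs ys /\
               r = (normv (xs - x0) ^+ 2 + normv (ys - y0) ^+ 2)%R].

End SaddlePoints.

Section PureCD.
Context {R : realType} {n d : nat}.
Variable A : 'M[R]_(n, d).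

Definition nnz : nat := #|[pred p : 'I_n * 'I_d | A p.1 p.2 != 0]|.

(* These are the sets J(i) and I(j). *)
Definition row_supp (i : 'I_n) : {set 'I_d} := [set j | A i j != 0]%SET.
Definition col_supp (j : 'I_d) : {set 'I_n} := [set i | A i j != 0]%SET.

Definition max_row_norm : R := \big[Num.max/0]_(i < n) normv (row i A)^T.

Section Algorithm.
Variables (g_ : 'I_d -> R -> \bar R) (h_ : 'I_n -> R -> \bar R).
Variables (tau : nat -> 'I_d -> R) (sigma : nat -> 'I_n -> R).
Variable theta : nat -> 'I_d -> R.

(* xbar is only meaningful on J(i); its other coordinates are multiplied by zero
   entries of A in ynew and do not enter x' either. *)
Definition pure_cd_step (k : nat) (i : 'I_n) (z : 'cV[R]_d * 'cV[R]_n) :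
    'cV[R]_d * 'cV[R]_n :=
  let: (x, y) := z in
  let xbar := \col_j (if j \in row_supp i then
      prox (tau k j) (g_ j) (x j 0 - tau k j * (A^T *m y) j 0) else x j 0) in
  let ynew :=
    prox (sigma k i) (h_ i) (y i 0 + sigma k i * (A *m xbar) i 0) in
  let x' := \col_j (if j \in row_supp i then
      xbar j 0 - tau k j * theta k j * A i j * (ynew - y i 0) else x j 0) in
  let y' := \col_l (if l == i then ynew else y l 0) in
  (x', y').

Fixpoint pure_cd (x0 : 'cV[R]_d) (y0 : 'cV[R]_n) (i_ : nat -> 'I_n) (k : nat) :
    'cV[R]_d * 'cV[R]_n :=
  if k is k'.+1 then pure_cd_step k' (i_ k') (pure_cd x0 y0 i_ k')
  else (x0, y0).

End Algorithm.

Section StepSizes.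
Variable mu : R.

Definition col_freq (j : 'I_d) : R := #|col_supp j|%:R / n%:R.

Fixpoint tau_tilde (k : nat) : R :=
  if k is k'.+1 then tau_tilde k' / Num.sqrt (1 + tau_tilde k')
  else Num.min n%:R^-1 (mu / (n%:R * max_row_norm)).

Fixpoint sigma (k : nat) : R :=
  if k is k'.+1 then sigma k' * Num.sqrt (1 + tau_tilde k')
  else max_row_norm^-1.

Definition tau (k : nat) (j : 'I_d) : R :=
  tau_tilde k / (mu * col_freq j - mu * (1 - col_freq j) * tau_tilde k).

Definition theta (k : nat) (j : 'I_d) : R :=
  col_freq j * n%:R / (1 + mu * tau k j).

End StepSizes.

(* Cost of K iterations: c0 * nnz for computing A^T y0, and c1 * |J(i_k)| for
   iteration k; c0 and c1 are the hidden constants of the cost model. *)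
Definition pure_cd_cost (c0 c1 : R) (i_ : nat -> 'I_n) (K : nat) : R :=
  c0 * nnz%:R + \sum_(k < K) c1 * #|row_supp (i_ k)|%:R.

End PureCD.

Section Sampling.
Context {R : realType} {disp : measure_display} {T : measurableType disp}.
Local Open Scope ereal_scope.

(* The i_k are random variables, uniform on 'I_n, and each i_k is independent of
   the past (i_0, ..., i_(k-1)). *)
Definition uniform_sampling n (P : probability T R) (i_ : nat -> T -> 'I_n) :
    Prop :=
  [/\ forall k a, measurable (i_ k @^-1` [set a]),
      forall k a, P (i_ k @^-1` [set a]) = (n%:R^-1)%:E &
      forall k (B : set 'I_n) (C : set {ffun 'I_k -> 'I_n}),
        let past := (fun w => [ffun l : 'I_k => i_ l w]) @^-1` C in
        P (i_ k @^-1` B `&` past) = P (i_ k @^-1` B) * P past].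

End Sampling.

(* Main.v *)
(* Fix a saddle point (xs, ys) and write t_k, s_k for tau_tilde and sigma.  The
   step sizes are chosen so that tau_k^(j) theta_k^(j) = n t_k / (mu (1 + t_k))
   does not depend on j and 1 - pi_j + pi_j / (1 + mu tau_k^(j)) = 1 / (1 + t_k).
   Adding the optimality conditions of the proximal steps to those of the saddle
   point, the bilinear terms cancel in the mean over i_k, and
     V_k = |x_k - xs|^2 + n t_k / (mu s_k) |y_k - ys|^2
   satisfies (1 + t_k) E V_(k+1) <= E V_k, where 1 + t_k = (t_k / t_(k+1))^2.
   Hence E V_K <= (t_K / t_0)^2 V_0, and t_K <= 3 / K because
   1 / t_(k+1) >= 1 / t_k + 1 / 3.  The primal solution is unique, so the bound
   may be minimized over all saddle points, which brings in Dstar. *)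

Require Import Defs.
From HB Require Import structures.
From mathcomp Require Import all_boot all_order all_algebra.
From mathcomp Require Import all_classical all_reals all_analysis.
From mathcomp Require Import measurable_realfun ring lra.
Set Implicit Arguments.
Unset Strict Implicit.
Unset Printing Implicit Defensive.
Import Order.TTheory GRing.Theory Num.Theory.
Import numFieldNormedType.Exports.
Local Open Scope classical_set_scope.
Local Open Scope ring_scope.

(** * One-dimensional proximal steps *)

Section Prox.
Context {R : realType}.

(** The Weierstrass theorem for extended-valued functions. *)
Lemma lsc_compact_min (X : topologicalType) (K : set X) (f : X -> \bar R) :
  compact K -> K !=set0 -> lower_semicontinuous f ->
  exists2 p, K p & forall u, K u -> (f p <= f u)%E.
Proof.
move=> /compact_near_coveringP cK [c Kc] lf; apply: contrapT => nomin.
have below p : K p -> exists2 u, K u & (f u < f p)%E.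
  move=> Kp; apply: contrapT => H; apply: nomin; exists p => // u Ku.
  by rewrite leNgt; apply/negP => lt_up; apply: H; exists u.
(* The sublevel sets through points of K generate a filter; compactness makes
   one of them lie strictly below all of K, including its own generator. *)
pose F := filter_from K (fun u => [set v | K v /\ (f v <= f u)%E]).
have FF : Filter F.
  apply: filter_from_filter; first by exists c.
  move=> i j Ki Kj; have [le_ij|/ltW le_ji] := leP (f i) (f j).
    by exists i => // v [Kv le_vi]; do 2!split=> //; exact: le_trans le_vi le_ij.
  by exists j => // v [Kv le_vj]; do 2!split=> //; exact: le_trans le_vj le_ji.
have [x Kx|u0 Ku0 H] := cK _ F (fun i x => (f i < f x)%E) FF.
  have [u Ku lt_ux] := below _ Kx.
  have [a le_ua lt_ax] : exists2 a, (f u <= a%:E)%E & (a%:E < f x)%E.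
    case: (f u) (f x) lt_ux => [a| |] [b| |] //= ab.
    - by exists a.
    - by exists a => //; rewrite ltry.
    - by exists (b - 1); rewrite ?leNye// lte_fin gtrBl.
    - by exists 0; rewrite ?leNye ?ltry.
  have [V Vx HV] := lf _ _ lt_ax.
  exists (V, [set v | K v /\ (f v <= f u)%E]); first by split=> //; exists u.
  case=> y v /= [Vy [_ le_vu]].
  exact: le_lt_trans le_vu (le_lt_trans le_ua (HV _ Vy)).
by have := H u0 (conj Ku0 (lexx _)) u0 Ku0; rewrite ltxx.
Qed.

(** Scalar counterparts of [convex_ereal] and [subdiff], for the components on which the proximal
    maps act. *)
Definition convex1 (f : R -> \bar R) :=
  forall x y t : R, 0 <= t <= 1 ->
    (f (t * x + (1 - t) * y)%R <= t%:E * f x + (1 - t)%:E * f y)%E.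

Definition subgrad1 (f : R -> \bar R) (c q : R) :=
  forall u, (f c + (q * (u - c))%:E <= f u)%E.

(** The affine minorant given by the subgradient [q] makes the proximal objective coercive, so
    minimizing over a segment around [c] suffices. *)
Lemma prox_exists (tau : R) (f : R -> \bar R) (x c q : R) :
  0 < tau -> lower_semicontinuous f -> f c \is a fin_num -> subgrad1 f c q ->
  prox_argmin tau f x (prox tau f x).
Proof.
move=> tau0 lf fc cq; rewrite /prox.
pose phi u := (f u + ((u - x) ^+ 2 / (2 * tau))%:E)%E.
suff [p Hp] : exists p, prox_argmin tau f x p by exact: xgetPex (ex_intro _ p Hp).
have lphi : lower_semicontinuous phi.
  move=> u a; rewrite /phi => H.
  (* A real [b] splits the strict bound [a]: near [u], [f] stays above [b] and the quadratic stays
     above [a - b]. *)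
  have [b [bH1 bH2]] : exists b : R, (b%:E < f u)%E /\ a - (u - x) ^+ 2 / (2 * tau) < b.
    move: H; case: (f u) => [v| |] //=.
      rewrite -EFinD lte_fin => H.
      exists ((v + (a - (u - x) ^+ 2 / (2 * tau))) / 2); rewrite lte_fin.
      by split; lra.
    by move=> _; exists (a - (u - x) ^+ 2 / (2 * tau) + 1); rewrite ltry ltrDl.
  have [V Vu HV] := lf _ _ bH1.
  have : {for u, continuous (fun y : R => (y - x) ^+ 2 / (2 * tau) : R)}.
    apply: cvgMr_tmp.
    rewrite [X in X @ _ --> _](_ : _ = (fun y => (y - x) * (y - x))); last first.
      by apply/funext => y; rewrite expr2.
    rewrite expr2; apply: cvgM; apply: cvgB => //; exact: cvg_cst.
  move=> /cvgr_gt /(_ (a - b)) gtab.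
  exists (V `&` [set y | a - b < (y - x) ^+ 2 / (2 * tau)]).
    by apply: filterI => //; apply: gtab; lra.
  move=> y [Vy /= aby].
  have := HV _ Vy; rewrite /phi; case: (f y) => [v| |] //; last by rewrite addye ?ltry.
  rewrite -EFinD !lte_fin; lra.
(* Outside [c - b, c + b] the affine minorant plus the quadratic exceeds phi c. *)
pose b := `|2 * (c - x + tau * q)|.
have b0 : 0 <= b by exact: normr_ge0.
have cK : [set` `[c - b, c + b]] c by rewrite /= in_itv /=; lra.
have [p Kp pmin] := lsc_compact_min (@segment_compact R (c - b) (c + b))
  (ex_intro _ c cK) lphi.
exists p => u; rewrite -!/(phi _).
have [Ku|nKu] := pselect ([set` `[c - b, c + b]] u); first exact: pmin.
apply: (@le_trans _ _ (phi c)).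
  by apply: pmin; rewrite /= in_itv /=; lra.
rewrite /phi; have := cq u; case: (f c) fc => [v| |] //= _.
case: (f u) => [w| |] //=; rewrite -?EFinD ?lee_fin ?leey // => H.
suff : q * (u - c) + (u - x) ^+ 2 / (2 * tau) >= (c - x) ^+ 2 / (2 * tau) by lra.
rewrite -subr_ge0.
(* Both factors of the numerator have the same sign once [u - c] exceeds [b] in absolute value. *)
have -> : q * (u - c) + (u - x) ^+ 2 / (2 * tau) - (c - x) ^+ 2 / (2 * tau) =
  ((u - c) * ((u - c) + 2 * (c - x + tau * q))) / (2 * tau).
  by field; rewrite gt_eqF.
apply: divr_ge0; last by rewrite mulr_ge0 // ltW.
have b1 : 2 * (c - x + tau * q) <= b by exact: ler_norm.
have b2 : - (2 * (c - x + tau * q)) <= b by rewrite /b -normrN; exact: ler_norm.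
have [uc|uc] : u - c < - b \/ b < u - c.
  move: nKu; rewrite /= in_itv /= => /negP; rewrite negb_and -!ltNge.
  by case/orP => ?; [left|right]; lra.
  by rewrite mulr_le0 //; lra.
by rewrite mulr_ge0 //; lra.
Qed.

(** Fermat's rule for the proximal step: convexity turns minimality along segments into a
    first-order inequality. The data at [c] ensure that a minimizer exists. *)
Lemma prox_subgrad (tau : R) (f : R -> \bar R) (x c q : R) :
  0 < tau -> convex1 f -> lower_semicontinuous f -> (forall u, f u != -oo)%E ->
  f c \is a fin_num -> subgrad1 f c q ->
  f (prox tau f x) \is a fin_num /\
  subgrad1 f (prox tau f x) ((x - prox tau f x) / tau).
Proof.
move=> tau0 cf lf fNy fc cq; have := prox_exists x tau0 lf fc cq.
set p := prox tau f x => pmin.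
have fp : f p \is a fin_num.
  rewrite fin_numE fNy /=; apply/eqP => fpy.
  by have := pmin c; rewrite fpy; case: (f c) fc.
split=> // u.
have := fNy u; case fuE: (f u) => [v| |] //= _; last by rewrite leey.
move: fp pmin; rewrite /prox_argmin/=; case fpE: (f p) => [w| |] //= _ pmin.
rewrite -EFinD lee_fin.
(* Compare p with the points of the segment from p to u, then let t tend to 0. *)
suff H t : 0 < t <= 1 ->
    w + (x - p) / tau * (u - p) - v <= t * ((u - p) ^+ 2 / (2 * tau)).
  rewrite -subr_le0; set a := (X in X <= 0).
  have {}H t : 0 < t <= 1 -> a <= t * ((u - p) ^+ 2 / (2 * tau)) by exact: H.
  set B := (u - p) ^+ 2 / (2 * tau) in H.
  have B0 : 0 <= B by rewrite divr_ge0 ?sqr_ge0// mulr_ge0// ltW.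
  rewrite leNgt; apply/negP => a0.
  (* This [t] keeps [t * B] below [a]; [B + 1] avoids a division by zero when [u = p]. *)
  have := H (Num.min 1 (a / (2 * (B + 1)))).
  have B1 : 0 < 2 * (B + 1) by lra.
  rewrite lt_min ltr01 divr_gt0 //= ge_min lexx /= => /(_ isT).
  apply/negP; rewrite -ltNge.
  apply: (@le_lt_trans _ _ (a / (2 * (B + 1)) * B)).
    by apply: ler_wpM2r => //; rewrite ge_min lexx orbT.
  rewrite mulrAC ltr_pdivrMr //; nra.
move=> /andP[t0 t1].
have := pmin (t * u + (1 - t) * p); have := cf u p t.
rewrite (ltW t0) t1 fuE fpE => /(_ isT).
rewrite -!EFinM -!EFinD; case: (f _) => [z| |] //=; rewrite -?EFinD.
rewrite !lee_fin => h1 h2.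
have {h1 h2} : w + (p - x) ^+ 2 / (2 * tau) <=
  t * v + (1 - t) * w + (t * u + (1 - t) * p - x) ^+ 2 / (2 * tau) by lra.
(* Expanding around [p] cancels the value at [p] and leaves a factor [t] to divide out. *)
have -> : (t * u + (1 - t) * p - x) ^+ 2 / (2 * tau) =
  (p - x) ^+ 2 / (2 * tau) +
  t * ((p - x) / tau * (u - p) + t * ((u - p) ^+ 2 / (2 * tau))).
  by field; rewrite gt_eqF.
have -> : (x - p) / tau = - ((p - x) / tau) by rewrite -mulNr opprB.
rewrite mulNr.
move: ((p - x) / tau * _) ((p - x) ^+ 2 / _) (_ * (_ / (2 * tau))) => D E G h.
have : t * (w - v - (D + G)) <= 0 by nra.
by rewrite pmulr_rle0 // => ?; lra.
Qed.

End Prox.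

(** * Coordinates of separable functions *)

Section Separable.
Context {R : realType}.

Definition upd m (v : 'cV[R]_m) (j : 'I_m) (t : R) : 'cV[R]_m :=
  \col_l (if l == j then t else v l 0).

Lemma upd_id m (v : 'cV[R]_m) j : upd v j (v j 0) = v.
Proof. by apply/colP => l; rewrite mxE; case: eqP => // ->. Qed.

Lemma upd_continuous m (v : 'cV[R]_m) j : continuous (upd v j).
Proof.
have -> : upd v j = fun t => upd v j 0 + t *: delta_mx j 0.
  apply/funext => t; apply/colP => l; rewrite !mxE eqxx andbT.
  by case: eqP => _; rewrite ?add0r ?mulr1// mulr0 addr0.
move=> t; apply: cvgD; first exact: cvg_cst.
by apply: cvgZr_tmp.
Qed.

Context {m : nat} (f : 'cV[R]_m -> \bar R) (f_ : 'I_m -> R -> \bar R).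
Hypotheses (pf : proper_fun f) (sf : separable f f_).

(** In extended addition -oo absorbs even +oo, so one component equal to -oo would make [f] equal to
    -oo at a constant vector. *)
Lemma coord_Ny j t : (f_ j t != -oo)%E.
Proof.
have [fNy _] := pf; apply/eqP => ft.
have := fNy (const_mx t); rewrite sf => /eqP; apply.
by rewrite (bigD1 j)//= mxE ft.
Qed.

Variable v : 'cV[R]_m.
Hypothesis fv : f v \is a fin_num.

Lemma coord_fin j : f_ j (v j 0) \is a fin_num.
Proof.
by move: fv; rewrite sf => /sum_fin_numP /(_ j); apply; rewrite ?mem_index_enum.
Qed.

(** The other components are finite at [v], so their sum is a real constant that cancels from
    inequalities. Properties of [f] thus pass to [f_ j]. *)
Lemma slice j : exists c : R, forall t, f (upd v j t) = (f_ j t + c%:E)%E.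
Proof.
exists (fine (\sum_(l < m | l != j) f_ l (v l 0%R))) => t.
rewrite fineK; last first.
  by apply/sum_fin_numP => l _ _; exact: coord_fin.
rewrite sf (bigD1 j)//= mxE eqxx; congr (_ + _)%E.
by apply: eq_bigr => l /negbTE lj; rewrite mxE lj.
Qed.

Lemma convex_coord j : convex_ereal f -> convex1 (f_ j).
Proof.
move=> cf x y t t01; have [c fE] := slice j.
have := cf (upd v j x) (upd v j y) t t01.
have -> : t *: upd v j x + (1 - t) *: upd v j y = upd v j (t * x + (1 - t) * y).
  by apply/colP => l; rewrite !mxE; case: eqP => // _; ring.
rewrite !fE !muleDr ?fin_num_adde_defl// addeACA -!EFinM -EFinD.
have -> : t * c + (1 - t) * c = c by ring.
by rewrite leeD2rE.
Qed.

Lemma lsc_coord j : lower_semicontinuous f -> lower_semicontinuous (f_ j).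
Proof.
move=> lf t a at_; have [c fE] := slice j.
have [|V Vt HV] := lf (upd v j t) (a + c).
  by rewrite fE EFinD lteD2rE.
exists (upd v j @^-1` V); first exact: upd_continuous.
by move=> s /HV; rewrite fE EFinD lteD2rE.
Qed.

Lemma subgrad_coord j q : subdiff f v q -> subgrad1 (f_ j) (v j 0) (q j 0).
Proof.
move=> sq u; have [c fE] := slice j.
have := sq (upd v j u); rewrite -{1}(upd_id v j) !fE.
have -> : dotv q (upd v j u - v) = q j 0 * (u - v j 0).
  rewrite /dotv (bigD1 j)//= big1 ?addr0 => [|l /negbTE lj].
    by rewrite !mxE eqxx.
  by rewrite !mxE lj subrr mulr0.
by rewrite addeAC leeD2rE.
Qed.

(** The subgradient inequalities of the components add up; those other than [j] inherit theirs from
    [q]. *)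
Lemma subdiff_upd j q t s :
  subdiff f v q -> subgrad1 (f_ j) t s -> subdiff f (upd v j t) (upd q j s).
Proof.
move=> sq ss u; rewrite /dotv !sf.
rewrite -sumEFin -big_split /=; apply: lee_sum => l _.
rewrite !mxE; case: eqP => [->|_]; first exact: ss.
exact: subgrad_coord.
Qed.

(* Strong convexity of f only speaks about points where all coordinates have a
   subgradient, hence the base point v with subdiff f v q. *)
Lemma strongly_convex_coord mu j q t s :
  strongly_convex mu f -> subdiff f v q -> subgrad1 (f_ j) t s ->
  forall u, (f_ j t + (s * (u - t) + mu / 2 * (u - t) ^+ 2)%:E <= f_ j u)%E.
Proof.
move=> scf sq ss u; have [c fE] := slice j.
have := scf (upd v j u) (upd v j t) (upd q j s).
rewrite inE => /(_ (subdiff_upd sq ss)); rewrite !fE.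
have dE (z : 'cV[R]_m) : dotv z (upd v j u - upd v j t) = z j 0 * (u - t).
  rewrite /dotv (bigD1 j)//= big1 ?addr0 => [|l /negbTE lj].
    by rewrite !mxE eqxx.
  by rewrite !mxE lj subrr mulr0.
rewrite /normv sqr_sqrtr; last by apply: sumr_ge0 => l _; rewrite -expr2 sqr_ge0.
rewrite !dE !mxE eqxx -addeA -EFinD addeAC leeD2rE// expr2.
Qed.

End Separable.

(** * Saddle points *)

Section Saddle.
Context {R : realType}.

Lemma dotvC m (u v : 'cV[R]_m) : dotv u v = dotv v u.
Proof. by apply: eq_bigr => i _; rewrite mulrC. Qed.

Lemma dotvDl m (u v w : 'cV[R]_m) : dotv (u + v) w = dotv u w + dotv v w.
Proof. by rewrite -big_split; apply: eq_bigr => i _; rewrite mxE mulrDl. Qed.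

Lemma dotvNl m (u w : 'cV[R]_m) : dotv (- u) w = - dotv u w.
Proof. by rewrite -sumrN; apply: eq_bigr => i _; rewrite mxE mulNr. Qed.

Lemma dotvBl m (u v w : 'cV[R]_m) : dotv (u - v) w = dotv u w - dotv v w.
Proof. by rewrite dotvDl dotvNl. Qed.

Lemma dotvBr m (u v w : 'cV[R]_m) : dotv w (u - v) = dotv w u - dotv w v.
Proof. by rewrite dotvC dotvBl !(dotvC w). Qed.

Lemma dotv_mulmx n d (A : 'M[R]_(n, d)) x y :
  dotv (A *m x) y = dotv (A^T *m y) x.
Proof.
rewrite /dotv; under eq_bigr do rewrite mxE mulr_suml.
rewrite exchange_big; apply: eq_bigr => j _; rewrite mxE mulr_suml.
by apply: eq_bigr => i _; rewrite mxE mulrAC.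
Qed.

Lemma normv_sqr m (u : 'cV[R]_m) : normv u ^+ 2 = \sum_(i < m) (u i 0) ^+ 2.
Proof.
rewrite /normv sqr_sqrtr /dotv => [|]; last first.
  by apply: sumr_ge0 => i _; rewrite -expr2 sqr_ge0.
by apply: eq_bigr => i _; rewrite expr2.
Qed.

Context {n d : nat} (A : 'M[R]_(n, d)).
Context (g : 'cV[R]_d -> \bar R) (hs : 'cV[R]_n -> \bar R).
Hypotheses (pg : proper_fun g) (ph : proper_fun hs).

(** The optimality conditions: each half of the saddle inequality, with one argument frozen, is a
    subgradient inequality. *)
Lemma saddle_kkt xs ys : saddle_point A g hs xs ys ->
  [/\ g xs \is a fin_num, hs ys \is a fin_num,
      subdiff g xs (- (A^T *m ys)) & subdiff hs ys (A *m xs)].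
Proof.
have [gNy [x1 gx1]] := pg; have [hNy [y1 hy1]] := ph.
move=> sp; rewrite /saddle_point /lagrangian in sp.
(* If [hs ys] were +oo, the saddle value would be -oo, below the value at [(xs, y1)]; otherwise
   [g xs] equal to +oo would make it +oo, above the value at [(x1, ys)]. *)
have [hys gxs] : hs ys \is a fin_num /\ g xs \is a fin_num.
  move: (sp x1 y1) (gNy x1) (hNy y1) (gNy xs) (hNy ys) => /andP[].
  case: (hs ys) => [a| |] //; case: (g xs) => [b| |] //;
  case: (g x1) gx1 => [a'| |] //; case: (hs y1) hy1 => [b'| |] //.
split=> // u.
- have /andP[_] := sp u ys; have := gNy u.
  case: (hs ys) hys => [a| |] //; case: (g xs) gxs => [b| |] // _ _.
  case: (g u) => [c _|_ _|/eqP//]; last by rewrite leey.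
  rewrite dotvNl dotvBr -!dotv_mulmx.
  move: (dotv (A *m xs) ys) (dotv (A *m u) ys) => p q.
  rewrite -!EFinN -!EFinD !lee_fin; lra.
- have /andP[+ _] := sp xs u; have := hNy u.
  case: (hs ys) hys => [a| |] //; case: (g xs) gxs => [b| |] // _ _.
  case: (hs u) => [c _|_ _|/eqP//]; last by rewrite leey.
  rewrite dotvBr; move: (dotv (A *m xs) ys) (dotv (A *m xs) u) => p q.
  rewrite -!EFinN -!EFinD !lee_fin; lra.
Qed.

Lemma subdiff_monotone m (f : 'cV[R]_m -> \bar R) u v p q :
  f u \is a fin_num -> f v \is a fin_num -> subdiff f u p -> subdiff f v q ->
  0 <= dotv (p - q) (u - v).
Proof.
move=> fu fv /(_ v) up /(_ u) vq; move: up vq.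
case: (f u) fu => [a| |] //; case: (f v) fv => [b| |] // _ _.
rewrite dotvBl !dotvBr.
move: (dotv p u) (dotv p v) (dotv q u) (dotv q v) => pu pv qu qv.
by rewrite -!EFinD !lee_fin; lra.
Qed.

(** The bilinear terms in the monotonicity inequalities of [g] and [hs] are opposite, so the strong
    convexity term of [g] is at most 0. *)
Lemma saddle_primal_unique (mu : R) xs ys xs' ys' : 0 < mu -> strongly_convex mu g ->
  saddle_point A g hs xs ys -> saddle_point A g hs xs' ys' -> xs = xs'.
Proof.
move=> mu0 scg /saddle_kkt[gx hy sx sy] /saddle_kkt[gx' hy' sx' sy'].
have hmono := subdiff_monotone hy hy' sy sy'.
have := scg xs' xs (- (A^T *m ys)); rewrite inE => /(_ sx).
have := sx' xs.
case: (g xs) gx => [a| |] //; case: (g xs') gx' => [b| |] // _ _.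
move: hmono; rewrite dotvBl 2!dotvBr (dotv_mulmx A xs) (dotv_mulmx A xs ys').
rewrite (dotv_mulmx A xs') (dotv_mulmx A xs' ys') 2!dotvNl 2!dotvBr.
pose q y x := dotv (A^T *m y) x; rewrite -!/(q _ _) => h0.
pose D := mu / 2 * normv (xs' - xs) ^+ 2; rewrite -/D.
move: (q ys xs) (q ys xs') (q ys' xs) (q ys' xs') h0 => r1 r2 r3 r4 h0.
rewrite -!EFinD !lee_fin => h1 h2.
have {h0 h1 h2 hy hy'} : D <= 0 by lra.
rewrite {}/D.
rewrite pmulr_rle0; last by rewrite divr_gt0.
rewrite normv_sqr => le0; apply/colP => j; apply/eqP; rewrite eq_sym -subr_eq0.
have := le0; rewrite le_eqVlt ltNge sumr_ge0 ?orbF => [|i _]; last exact: sqr_ge0.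
rewrite psumr_eq0 => [|i _]; last exact: sqr_ge0.
by move=> /allP /(_ j); rewrite mem_index_enum !mxE sqrf_eq0 => /(_ isT).
Qed.

End Saddle.

(** * Mean decrease over one step *)

Section OneStep.
Context {R : realType}.

(* The right-hand side exceeds the left-hand side by at least
   k (x - xb)^2 + s mu (xb - z)^2 with k = N (p - (1 - p) tt) / (1 + tt). *)
Lemma primal_coord (N mu tt p tau s x xb z a b : R) :
  0 < N -> 0 < mu -> 0 < tt -> 0 < p - (1 - p) * tt ->
  tau = tt / (mu * p - mu * (1 - p) * tt) -> s = N * tt / (mu * (1 + tt)) ->
  mu * (xb - z) ^+ 2 <= ((x - tau * a - xb) / tau + b) * (xb - z) ->
  N * ((1 - p) * (x - z) ^+ 2 + p * (xb - z) ^+ 2) <=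
    N / (1 + tt) * (x - z) ^+ 2 + 2 * s * (a - b) * (z - xb).
Proof.
move=> N0 mu0 tt0 p0 tauE sE H.
pose k := N / (1 + tt) * (p - (1 - p) * tt).
have k0 : 0 <= k by rewrite mulr_ge0 ?ltW// divr_gt0//; lra.
have s0 : 0 < s by rewrite sE divr_gt0 ?mulr_gt0//; lra.
have : 0 <= 2 * s * (((x - tau * a - xb) / tau + b) * (xb - z) - mu * (xb - z) ^+ 2).
  by rewrite mulr_ge0 ?subr_ge0// mulr_ge0// ltW.
have <- : N / (1 + tt) * (x - z) ^+ 2 + 2 * s * (a - b) * (z - xb) -
  N * ((1 - p) * (x - z) ^+ 2 + p * (xb - z) ^+ 2) -
  (k * (x - xb) ^+ 2 + s * mu * (xb - z) ^+ 2) =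
  2 * s * (((x - tau * a - xb) / tau + b) * (xb - z) - mu * (xb - z) ^+ 2).
  rewrite /k sE tauE; field.
  by rewrite !gt_eqF//=; nra.
have : 0 <= k * (x - xb) ^+ 2 by rewrite mulr_ge0 ?sqr_ge0.
have : 0 <= s * mu * (xb - z) ^+ 2 by rewrite mulr_ge0 ?sqr_ge0// mulr_ge0 ?ltW.
lra.
Qed.

(** The three-point inequality of the dual proximal step: its slack is exactly [2 * s] times the
    product in the hypothesis. *)
Lemma dual_coord (sig s y yb z c c' : R) : 0 < sig -> 0 <= s ->
  0 <= ((y + sig * c - yb) / sig - c') * (yb - z) ->
  s / sig * ((yb - z) ^+ 2 - (y - z) ^+ 2) <=
    2 * s * (c - c') * (yb - z) - s / sig * (yb - y) ^+ 2.
Proof.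
move=> sig0 s0 H; rewrite -subr_ge0.
have -> : 2 * s * (c - c') * (yb - z) - s / sig * (yb - y) ^+ 2 -
  s / sig * ((yb - z) ^+ 2 - (y - z) ^+ 2) =
  2 * s * (((y + sig * c - yb) / sig - c') * (yb - z)).
  by field; rewrite gt_eqF.
by rewrite mulr_ge0// mulr_ge0.
Qed.

Context {n d : nat} (A : 'M[R]_(n, d)).

Lemma col_freqE j : (0 < n)%N ->
  n%:R * col_freq A j = \sum_(i < n) (A i j != 0)%:R.
Proof.
move=> n0; rewrite /col_freq mulrC divfK ?pnatr_eq0 -?lt0n// -sum1_card natr_sum.
rewrite [LHS]big_mkcond /=; apply: eq_bigr => i _; rewrite inE.
by case: (A i j == 0).
Qed.

Variables (mu tt sig s : R) (tau : 'I_d -> R).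
Variables (x xb xs : 'cV[R]_d) (y yb ys : 'cV[R]_n).
Hypotheses (n0 : (0 < n)%N) (mu0 : 0 < mu) (tt0 : 0 < tt) (sig0 : 0 < sig).
Hypothesis freq0 : forall j, 0 < col_freq A j - (1 - col_freq A j) * tt.
Hypothesis tauE : forall j,
  tau j = tt / (mu * col_freq A j - mu * (1 - col_freq A j) * tt).
Hypothesis sE : s = n%:R * tt / (mu * (1 + tt)).
Hypothesis step_small : forall i, s * sig * normv (row i A)^T ^+ 2 <= 1.
Hypothesis primal : forall j, mu * (xb j 0 - xs j 0) ^+ 2 <=
  ((x j 0 - tau j * (A^T *m y) j 0 - xb j 0) / tau j + (A^T *m ys) j 0) *
  (xb j 0 - xs j 0).
Hypothesis dual : forall i,
  0 <= ((y i 0 + sig * (A *m xb) i 0 - yb i 0) / sig - (A *m xs) i 0) *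
       (yb i 0 - ys i 0).

(** Here [xb] and [yb] are updated in all coordinates at once and do not depend on the sampled row;
    row [i] only selects which entries are kept. The scalar [s] is the common value of tau_j
    theta_j. *)
Let xnew i : 'cV[R]_d := \col_j
  (if A i j != 0 then xb j 0 - s * A i j * (yb i 0 - y i 0) else x j 0).
Let ynew i : 'cV[R]_n := \col_l (if l == i then yb i 0 else y l 0).

Let s_ge0 : 0 <= s.
Proof. by rewrite sE divr_ge0// mulr_ge0 ?addr_ge0// ltW. Qed.

(** For each coordinate, summing over the rows turns the indicators of the support into n pi_j, and
    [primal_coord] applies. *)
Lemma sum_primal :
  \sum_i normv (xnew i - xs) ^+ 2 <= n%:R / (1 + tt) * normv (x - xs) ^+ 2
    - 2 * s * (\sum_i (A *m (xb - xs)) i 0 * (yb i 0 - ys i 0))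
    + s ^+ 2 * \sum_i normv (row i A)^T ^+ 2 * (yb i 0 - y i 0) ^+ 2.
Proof.
pose D i := yb i 0 - y i 0; pose w j := xb j 0 - xs j 0.
(* One formula covers both cases, because the correction carries the factor [A i j] and vanishes off
   the support. *)
have entry i j : (xnew i - xs) j 0 ^+ 2 = (1 - (A i j != 0)%:R) * (x j 0 - xs j 0) ^+ 2
   + (A i j != 0)%:R * w j ^+ 2 - 2 * s * (w j * (A i j * D i))
   + s ^+ 2 * (A i j ^+ 2 * D i ^+ 2).
  rewrite !mxE; case: (eqVneq (A i j) 0) => [->|_] /=; rewrite /D /w; ring.
have coord j : \sum_i (xnew i - xs) j 0 ^+ 2 <=
    n%:R / (1 + tt) * (x j 0 - xs j 0) ^+ 2
    - 2 * s * (w j * \sum_i A i j * (yb i 0 - ys i 0))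
    + s ^+ 2 * \sum_i A i j ^+ 2 * D i ^+ 2.
  under eq_bigr do rewrite entry.
  rewrite !big_split/= sumrN -!mulr_sumr -!mulr_suml.
  rewrite sumrB -col_freqE// sumr_const card_ord.
  have := primal_coord _ mu0 tt0 (freq0 j) (tauE j) sE (primal j).
  rewrite ltr0n => /(_ n0).
  (* The corrections move the coupling from [y] to [yb], where it can cancel against the dual
     step. *)
  have -> : \sum_i A i j * (yb i 0 - ys i 0) =
      \sum_i A i j * D i + ((A^T *m y) j 0 - (A^T *m ys) j 0).
    rewrite !mxE -sumrB -big_split/=; apply: eq_bigr => i _.
    by rewrite !mxE /D; ring.
  rewrite /w; lra.
under eq_bigr do rewrite normv_sqr.
rewrite exchange_big/=; apply: (le_trans (ler_sum _ (fun j _ => coord j))).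
rewrite !big_split/= sumrN -!mulr_sumr normv_sqr.
rewrite le_eqVlt; apply/orP; left; apply/eqP; congr (_ * _ - _ * _ + _ * _).
- by apply: eq_bigr => j _; rewrite !mxE.
- under [RHS]eq_bigr do rewrite mxE mulr_suml.
  rewrite [RHS]exchange_big; apply: eq_bigr => j _; rewrite mulr_sumr.
  by apply: eq_bigr => i _; rewrite !mxE /w; ring.
- under [RHS]eq_bigr do rewrite normv_sqr mulr_suml.
  rewrite [RHS]exchange_big; apply: eq_bigr => j _.
  by apply: eq_bigr => i _; rewrite !mxE.
Qed.

(** Each [ynew i] differs from [y] in entry [i] only, so [dual_coord] is summed once per row. The
    coupling term is opposite to that of [sum_primal]. *)
Lemma sum_dual :
  s / sig * \sum_i normv (ynew i - ys) ^+ 2 <=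
    n%:R * (s / sig) * normv (y - ys) ^+ 2
    + 2 * s * (\sum_i (A *m (xb - xs)) i 0 * (yb i 0 - ys i 0))
    - s / sig * \sum_i (yb i 0 - y i 0) ^+ 2.
Proof.
have normE i : normv (ynew i - ys) ^+ 2 =
    normv (y - ys) ^+ 2 + ((yb i 0 - ys i 0) ^+ 2 - (y i 0 - ys i 0) ^+ 2).
  rewrite !normv_sqr (bigD1 i)//= [in RHS](bigD1 i)//= !mxE eqxx.
  rewrite (eq_bigr (fun l => (y - ys) l 0 ^+ 2)) => [|l /negbTE li].
    by ring.
  by rewrite !mxE li.
under eq_bigr do rewrite normE.
rewrite big_split/= sumr_const card_ord mulrDr -addrA.
apply: lerD; first by rewrite -[_ *+ _]mulr_natl mulrCA mulrA.
rewrite !mulr_sumr -sumrB; apply: ler_sum => i _.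
have := dual_coord sig0 s_ge0 (dual i).
have -> : (A *m (xb - xs)) i 0 = (A *m xb) i 0 - (A *m xs) i 0.
  by rewrite mulmxBr !mxE.
by rewrite mulrA.
Qed.

(** The coupling terms cancel, and [step_small] lets the negative squares of the dual increments
    absorb the squared primal corrections. *)
Lemma mean_descent :
  n%:R^-1 * \sum_i (normv (xnew i - xs) ^+ 2 + s / sig * normv (ynew i - ys) ^+ 2)
    <= (1 + tt)^-1 * normv (x - xs) ^+ 2 + s / sig * normv (y - ys) ^+ 2.
Proof.
rewrite ler_pdivrMl ?ltr0n// big_split/= -mulr_sumr.
have := lerD sum_primal sum_dual.
suff : s ^+ 2 * \sum_i normv (row i A)^T ^+ 2 * (yb i 0 - y i 0) ^+ 2 <=
       s / sig * \sum_i (yb i 0 - y i 0) ^+ 2 by lra.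
rewrite !mulr_sumr; apply: ler_sum => i _; rewrite mulrA ler_wpM2r ?sqr_ge0//.
rewrite ler_pdivlMr// (_ : _ * sig = s * (s * sig * normv (row i A)^T ^+ 2)).
  by rewrite ler_piMr.
by rewrite expr2; ring.
Qed.

End OneStep.

(** * Step sizes *)

Section StepSizes.
Context {R : realType} {n d : nat} (A : 'M[R]_(n, d)) (mu : R).

Lemma max_row_norm_ge i : normv (row i A)^T <= max_row_norm A.
Proof. exact: le_bigmax_cond. Qed.

Lemma max_row_norm_gt0 i j : A i j != 0 -> 0 < max_row_norm A.
Proof.
move=> Aij; apply: lt_le_trans (max_row_norm_ge i).
rewrite /normv sqrtr_gt0 /dotv (bigD1 j)//= !mxE -expr2.
apply: ltr_wpDr; last by rewrite lt_def sqrf_eq0 Aij sqr_ge0.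
by apply: sumr_ge0 => l _; rewrite -expr2 sqr_ge0.
Qed.

Local Notation L := (max_row_norm A).
Local Notation tt := (tau_tilde A mu).
Local Notation sg := (sigma A mu).
Hypotheses (n0 : (0 < n)%N) (mu0 : 0 < mu) (L0 : 0 < L).

Let N0 : 0 < n%:R :> R. Proof. by rewrite ltr0n. Qed.

Lemma tau_tilde_gt0 k : 0 < tt k.
Proof.
elim: k => [|k IH] /=; first by rewrite lt_min invr_gt0 N0 divr_gt0 ?mulr_gt0.
by rewrite divr_gt0// sqrtr_gt0 addr_gt0.
Qed.

(** Read as (1 + t_k)^-1 = (t_(k+1) / t_k)^2, this makes the contraction factors telescope. *)
Lemma tau_tildeS_sqr k : tt k.+1 ^+ 2 = (1 + tt k)^-1 * tt k ^+ 2.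
Proof.
rewrite /= expr_div_n sqr_sqrtr ?addr_ge0 ?ltW ?tau_tilde_gt0//.
by rewrite mulrC.
Qed.

Lemma tau_tilde_le k : tt k <= n%:R^-1.
Proof.
elim: k => [|k] /=; first by rewrite ge_min lexx.
apply: le_trans; rewrite ler_pdivrMr ?sqrtr_gt0 ?addr_gt0 ?tau_tilde_gt0//.
have t0 := ltW (tau_tilde_gt0 k).
by rewrite ler_peMr// -[X in X <= _]sqrtr1 ler_wsqrtr// lerDl.
Qed.

Lemma sigma_gt0 k : 0 < sg k.
Proof.
elim: k => [|k IH] /=; first by rewrite invr_gt0.
by rewrite mulr_gt0// sqrtr_gt0 addr_gt0// tau_tilde_gt0.
Qed.

Lemma tau_tilde_sigma k : tt k * sg k = tt 0%N * sg 0%N.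
Proof.
have q0 l : 0 < Num.sqrt (1 + tt l) by rewrite sqrtr_gt0 addr_gt0// tau_tilde_gt0.
by elim: k => // k <- /=; rewrite mulrACA mulVf ?mulr1// gt_eqF.
Qed.

(** Inversion turns the minimum defining the first step into the maximum in the bound on K. *)
Lemma tau_tilde0_inv : (tt 0%N)^-1 = n%:R * Num.max 1 (L / mu).
Proof.
have h : mu / (n%:R * L) = (n%:R * (L / mu))^-1.
  by field; rewrite !gt_eqF.
rewrite /= h maxr_pMr ?ltW// mulr1.
have r0 : 0 < n%:R * (L / mu) by rewrite mulr_gt0// divr_gt0.
case: (leP (n%:R : R) (n%:R * (L / mu))) => c.
  by rewrite min_r ?invrK// lef_pV2 // posrE.
by rewrite min_l ?invrK// lef_pV2 ?ltW// posrE.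
Qed.

(** As [tt k * sg k] is constant in [k], the bound reduces to [k = 0], where the second entry of the
    minimum gives it. It provides [step_small]. *)
Lemma primal_dual_step_le1 k :
  n%:R * tt k / (mu * (1 + tt k)) * sg k * L ^+ 2 <= 1.
Proof.
have t0 := tau_tilde_gt0 k.
have : tt k * sg k * (n%:R * L ^+ 2) <= mu.
  rewrite tau_tilde_sigma /=.
  apply: (@le_trans _ _ (mu / (n%:R * L) / L * (n%:R * L ^+ 2))).
    apply: ler_wpM2r; first by rewrite mulr_ge0 ?sqr_ge0.
    apply: ler_wpM2r; first by rewrite invr_ge0 ltW.
    by rewrite ge_min lexx orbT.
  rewrite le_eqVlt; apply/orP; left; apply/eqP; field.
  by rewrite !gt_eqF.
have -> : n%:R * tt k / (mu * (1 + tt k)) * sg k * L ^+ 2 =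
   tt k * sg k * (n%:R * L ^+ 2) / (mu * (1 + tt k)).
  by field; rewrite !gt_eqF// addr_gt0.
move=> h; rewrite ler_pdivrMr ?mul1r ?mulr_gt0 ?addr_gt0//.
by apply: le_trans h _; rewrite ler_peMr ?ltW// ltrDl.
Qed.

(** The right-hand side is the weight [s / sig] of [mean_descent]. Relative to the weight at step k
    it carries the factor (1 + t_k)^-1, so the dual term contracts like the primal one. *)
Lemma dual_weightS k : n%:R * tt k.+1 / (mu * sg k.+1) =
  n%:R * tt k / (mu * (1 + tt k)) / sg k.
Proof.
have t0 := tau_tilde_gt0 k; have s0 := sigma_gt0 k.
have q0 : 0 < Num.sqrt (1 + tt k) by rewrite sqrtr_gt0 addr_gt0.
have -> : 1 + tt k = Num.sqrt (1 + tt k) ^+ 2.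
  by rewrite sqr_sqrtr// addr_ge0// ltW.
by rewrite /=; field; rewrite !gt_eqF.
Qed.

(** This bounds V_0 by the unweighted distance that defines [Dstar]. *)
Lemma dual_weight0_le1 : n%:R * tt 0%N / (mu * sg 0%N) <= 1.
Proof.
rewrite ler_pdivrMr ?mul1r ?mulr_gt0 ?sigma_gt0// /=.
rewrite mulrC -ler_pdivlMr//; apply: (@le_trans _ _ (mu / (n%:R * L))).
  by rewrite ge_min lexx orbT.
by rewrite invfM mulrA mulrAC.
Qed.

Lemma tau_tilde_decay k : k%:R * tt k <= 3.
Proof.
have t0 := tau_tilde_gt0.
have H l : l%:R / 3 <= (tt l)^-1.
  elim: l => [|l IH]; first by rewrite mul0r invr_ge0 ltW.
  (* Hence u = 1 / t_l is at least 1, which is more than the final comparison u / 3 >= 1 / 9 asks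
     for. *)
  have t1 : tt l <= 1.
    apply: le_trans (tau_tilde_le l) _.
    by rewrite invf_le1// ler1n.
  have u0 : 1 <= (tt l)^-1 by rewrite invf_ge1.
  have : (tt l)^-1 + 3^-1 <= (tt l.+1)^-1.
    rewrite -(@ler_pXn2r _ 2)// ?nnegrE ?invr_ge0 ?addr_ge0 ?invr_ge0 ?ltW//.
    rewrite exprVn tau_tildeS_sqr invfM invrK -exprVn.
    have -> : (1 + tt l) * (tt l)^-1 ^+ 2 = (tt l)^-1 ^+ 2 + (tt l)^-1.
      by field; rewrite gt_eqF.
    move: u0; move: (tt l)^-1 => u u0.
    (* With u = 1 / t_l the recursion is u' = sqrt (u^2 + u) >= u + 1/3. *)
    have -> : (u + 3^-1) ^+ 2 = u ^+ 2 + 2 / 3 * u + 9^-1 by field.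
    lra.
  apply: le_trans; rewrite -natr1 mulrDl div1r; lra.
rewrite -ler_pdivlMr//; have := H k; lra.
Qed.

Context {j : 'I_d}.
Hypothesis colj : (0 < #|col_supp A j|)%N.
Local Notation p := (col_freq A j).

Lemma col_freq_ge : n%:R^-1 <= p.
Proof. by rewrite /col_freq ler_peMl ?invr_ge0 ?ler0n// ler1n. Qed.

Lemma col_freq_le1 : p <= 1.
Proof.
rewrite /col_freq ler_pdivrMr// mul1r ler_nat.
by rewrite -[leqRHS]card_ord max_card.
Qed.

(** Since t_k <= 1 / n <= pi_j, the quantity pi_j - t_k + pi_j t_k is positive. Times [mu] it is the
    denominator of [tau]. *)
Lemma freq_gap k : 0 < p - (1 - p) * tt k.
Proof.
have t0 := tau_tilde_gt0 k; have t1 := tau_tilde_le k.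
have p1 := col_freq_le1; have p0 := col_freq_ge.
have n1 : 0 < n%:R^-1 :> R by rewrite invr_gt0.
move: (tt k) (n%:R^-1) p t0 t1 p1 p0 n1 => t m q ? ? ? ? ?; nra.
Qed.

Lemma tau_gt0 k : 0 < tau A mu k j.
Proof.
rewrite /tau divr_gt0 ?tau_tilde_gt0// -mulrA -mulrBr mulr_gt0//.
exact: freq_gap.
Qed.

(** Here 1 + mu tau_j = pi_j (1 + t) / (pi_j - (1 - pi_j) t), so the frequencies cancel in the
    product. *)
Lemma tau_theta k :
  tau A mu k j * theta A mu k j = n%:R * tt k / (mu * (1 + tt k)).
Proof.
have t0 := tau_tilde_gt0 k; have p0 := lt_le_trans _ col_freq_ge.
have {}p0 : 0 < p by apply: p0; rewrite invr_gt0.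
have g0 := freq_gap k.
rewrite /theta /tau; move: (tt k) p t0 p0 g0 => t q t0 q0 g0; field.
have g1 : 0 < mu * (q - (1 - q) * t) by rewrite mulr_gt0.
have g2 : 0 < mu * q * (1 + t) by rewrite !mulr_gt0 ?addr_gt0.
by rewrite !gt_eqF//; nra.
Qed.

End StepSizes.

(** * Expectations over the sampled indices *)

Section Sampling.
Context {R : realType} {disp : measure_display} {T : measurableType disp}.
Variable P : probability T R.

Lemma ge0_expectation_le (F G : T -> R) : measurable_fun setT F ->
  measurable_fun setT G -> (forall w, 0 <= F w <= G w) ->
  ('E_P[F] <= 'E_P[G])%E.
Proof.
move=> mF mG FG; rewrite unlock.
apply: ge0_le_integral => //.
- by move=> w _; rewrite lee_fin; case/andP: (FG w).
- exact/measurable_EFinP.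
- exact/measurable_EFinP.
- by move=> w _; rewrite lee_fin; case/andP: (FG w).
Qed.

(** A function of a finite-valued variable is a finite combination of indicators of its level
    sets. *)
Lemma expectation_finite (I : finType) (X : T -> I) (phi : I -> R) :
  (forall a, measurable (X @^-1` [set a])) -> (forall a, 0 <= phi a) ->
  ('E_P[fun w => phi (X w)] = \sum_a (phi a)%:E * P (X @^-1` [set a]))%E.
Proof.
move=> mX phi0; rewrite unlock.
have E w : (phi (X w))%:E = (\sum_a (phi a)%:E * (\1_(X @^-1` [set a]) w)%:E)%E.
  rewrite (bigD1 (X w))//= indicE mem_set// mule1 big1 ?adde0// => a aX.
  rewrite indicE memNset ?mule0// => /= Xa.
  by move: aX; rewrite Xa eqxx.
under eq_integral do rewrite E.
rewrite ge0_integral_sum//.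
- apply: eq_bigr => a _; rewrite ge0_integralZl_EFin//.
  + by rewrite integral_indic// setIT.
  + exact/measurable_EFinP/measurable_indic.
- by move=> a; apply: measurable_funeM; exact/measurable_EFinP/measurable_indic.
- by move=> a w _; rewrite mule_ge0// lee_fin.
Qed.

Context {n : nat} (i_ : nat -> T -> 'I_n).
Hypothesis unif : uniform_sampling P i_.

(** The history takes values in a finite type, so every function of it is measurable. *)
Definition past k (w : T) : {ffun 'I_k -> 'I_n} := [ffun l : 'I_k => i_ l w].

Lemma measurable_index k (B : set 'I_n) : measurable (i_ k @^-1` B).
Proof.
have [mi _ _] := unif.
rewrite [X in measurable X](_ : _ = \bigcup_(a in B) (i_ k @^-1` [set a])).
  by apply: fin_bigcup_measurable => //; exact: finite_finset.
apply/seteqP; split=> [w /= Bw|w [a Ba /= ->]//].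
by exists (i_ k w).
Qed.

Lemma measurable_past k v : measurable (past k @^-1` [set v]).
Proof.
rewrite [X in measurable X](_ : _ =
    \bigcap_(l in [set: 'I_k]) (i_ l @^-1` [set v l])).
  apply: fin_bigcap_measurable => [|l _]; first exact: finite_finset.
  exact: measurable_index.
apply/seteqP; split=> [w /= <- l _|w H] /=; first by rewrite ffunE.
by apply/ffunP => l; rewrite ffunE; exact: H.
Qed.

(** Conditioning on the past in elementary form: by independence the joint law of the new index and
    the history is a product, with uniform first factor. *)
Lemma expectation_next k (phi : 'I_n -> {ffun 'I_k -> 'I_n} -> R) :
  (forall i v, 0 <= phi i v) ->
  ('E_P[fun w => phi (i_ k w) (past k w)] =
  'E_P[fun w => (n%:R^-1 * \sum_i phi i (past k w))%R])%E.
Proof.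
move=> phi0; have [_ pi_ indep] := unif.
have preE i v : (fun w => (i_ k w, past k w)) @^-1` [set (i, v)] =
    i_ k @^-1` [set i] `&` past k @^-1` [set v].
  apply/seteqP; split=> w /=; first by case=> -> ->.
  by case=> -> ->.
rewrite (@expectation_finite _ (fun w => (i_ k w, past k w))
  (fun a => phi a.1 a.2))//; last first.
  by move=> [i v]; rewrite preE; apply: measurableI;
    [exact: measurable_index|exact: measurable_past].
rewrite (@expectation_finite _ (past k) (fun v => n%:R^-1 * \sum_i phi i v)).
- transitivity (\sum_i \sum_v (phi i v)%:E *
      P (i_ k @^-1` [set i] `&` past k @^-1` [set v]))%E.
    by rewrite pair_bigA; apply: eq_bigr => -[i v] _; rewrite preE.
  rewrite exchange_big/=; apply: eq_bigr => v _.
  rewrite mulr_sumr -sumEFin ge0_sume_distrl => [|i _]; last first.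
    by rewrite lee_fin mulr_ge0.
  apply: eq_bigr => i _.
  by rewrite indep pi_ muleA -EFinM mulrC.
- exact: measurable_past.
- by move=> v; rewrite mulr_ge0 ?invr_ge0 ?sumr_ge0.
Qed.

Lemma measurable_past_fun k (phi : {ffun 'I_k -> 'I_n} -> R) :
  measurable_fun setT (fun w => phi (past k w)).
Proof.
move=> _ Y mY; rewrite setTI.
rewrite [X in measurable X](_ : _ =
    \bigcup_(v in [set v | Y (phi v)]) (past k @^-1` [set v])).
  apply: fin_bigcup_measurable => [|v _]; first exact: finite_finset.
  exact: measurable_past.
apply/seteqP; split=> [w /= Yw|w [v Yv /= ->]//].
by exists (past k w).
Qed.

End Sampling.

(** * The algorithm *)

Section PureCDStep.
Context {R : realType} {n d : nat} (A : 'M[R]_(n, d)).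
Variables (g : 'cV[R]_d -> \bar R) (g_ : 'I_d -> R -> \bar R).
Variables (hs : 'cV[R]_n -> \bar R) (h_ : 'I_n -> R -> \bar R).
Variables (mu : R) (xs : 'cV[R]_d) (ys : 'cV[R]_n).
Hypotheses (n0 : (0 < n)%N) (colA : forall j, (0 < #|col_supp A j|)%N).
Hypotheses (pg : proper_fun g) (cg : convex_ereal g).
Hypotheses (lg : lower_semicontinuous g) (sg : separable g g_).
Hypotheses (ph : proper_fun hs) (ch : convex_ereal hs).
Hypotheses (lh : lower_semicontinuous hs) (sh : separable hs h_).
Hypotheses (mu0 : 0 < mu) (scg : strongly_convex mu g).
Hypothesis sp : saddle_point A g hs xs ys.

(** Strong convexity is used in both directions between the proximal point and [xs j 0]; the two
    halves [mu / 2] add up to [mu]. *)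
Lemma prox_primal (t x : R) (j : 'I_d) : 0 < t ->
  mu * (prox t (g_ j) x - xs j 0) ^+ 2 <=
  ((x - prox t (g_ j) x) / t + (A^T *m ys) j 0) * (prox t (g_ j) x - xs j 0).
Proof.
move=> t0; have [gxs _ sx _] := saddle_kkt pg ph sp.
have sxj := subgrad_coord sg gxs j sx.
have gxj := coord_fin sg gxs j.
have [gp sp_] := prox_subgrad x t0 (convex_coord sg gxs j cg)
  (lsc_coord sg gxs (j := j) lg) (coord_Ny pg sg j) gxj sxj.
move: (prox t (g_ j) x) gp sp_ => p gp sp_.
have := strongly_convex_coord sg gxs scg sx sp_ (xs j 0).
have := strongly_convex_coord sg gxs scg sx sxj p.
move: gp gxj; case: (g_ j p) => [a| |] //; case: (g_ j (xs j 0)) => [b| |] // _ _.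
have -> : (- (A^T *m ys)) j 0 = - (A^T *m ys) j 0 by rewrite mxE.
move: (xs j 0) ((A^T *m ys) j 0) ((x - p) / t) => z q r.
rewrite -!EFinD !lee_fin => h1 h2; nra.
Qed.

(** Monotonicity of the subdifferential of [h_ i], between the proximal point and [ys i 0]. *)
Lemma prox_dual (t y : R) (i : 'I_n) : 0 < t ->
  0 <= ((y - prox t (h_ i) y) / t - (A *m xs) i 0) * (prox t (h_ i) y - ys i 0).
Proof.
move=> t0; have [_ hys _ sy] := saddle_kkt pg ph sp.
have syi := subgrad_coord sh hys i sy.
have hyi := coord_fin sh hys i.
have [hp sp_] := prox_subgrad y t0 (convex_coord sh hys i ch)
  (lsc_coord sh hys (j := i) lh) (coord_Ny ph sh i) hyi syi.
move: (prox t (h_ i) y) hp sp_ => p hp sp_.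
have := sp_ (ys i 0); have := syi p.
move: hp hyi; case: (h_ i p) => [a| |] //; case: (h_ i (ys i 0)) => [b| |] // _ _.
move: (ys i 0) ((A *m xs) i 0) ((y - p) / t) => z q r.
rewrite -!EFinD !lee_fin => h1 h2; nra.
Qed.

Local Notation step :=
  (pure_cd_step A g_ h_ (tau A mu) (fun k _ => sigma A mu k) (theta A mu)).

Definition lyapunov k (z : 'cV[R]_d * 'cV[R]_n) : R :=
  normv (z.1 - xs) ^+ 2 +
  n%:R * tau_tilde A mu k / (mu * sigma A mu k) * normv (z.2 - ys) ^+ 2.

Lemma mean_lyapunov k z : 0 < max_row_norm A ->
  n%:R^-1 * \sum_i lyapunov k.+1 (step k i z) <=
  (1 + tau_tilde A mu k)^-1 * lyapunov k z.
Proof.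
move=> L0; case: z => x y.
set tt := tau_tilde A mu k; set sig := sigma A mu k.
have tt0 : 0 < tt by exact: tau_tilde_gt0.
have sig0 : 0 < sig by exact: sigma_gt0.
pose s := n%:R * tt / (mu * (1 + tt)).
pose xb : 'cV[R]_d := \col_j prox (tau A mu k j) (g_ j)
  (x j 0 - tau A mu k j * (A^T *m y) j 0).
pose yb : 'cV[R]_n := \col_i prox sig (h_ i) (y i 0 + sig * (A *m xb) i 0).
have stepE i : step k i (x, y) =
    (\col_j (if A i j != 0 then xb j 0 - s * A i j * (yb i 0 - y i 0) else x j 0),
     \col_l (if l == i then yb i 0 else y l 0)).
  (* The [xbar] of the algorithm and [xb] differ only where [A i j = 0], so row [i] has the same
     product with both. *)
  have ynewE : prox sig (h_ i) (y i 0 + sig * (A *m \col_j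
      (if j \in row_supp A i then prox (tau A mu k j) (g_ j)
         (x j 0 - tau A mu k j * (A^T *m y) j 0) else x j 0)) i 0) = yb i 0.
    rewrite [yb i 0]mxE; congr (prox _ _ (_ + _ * _)).
    rewrite ![(A *m _) i 0]mxE; apply: eq_bigr => j _; rewrite !mxE inE.
    by case: eqP => //= ->; rewrite !mul0r.
  rewrite /pure_cd_step ynewE; congr (_, _).
  apply/colP => j; rewrite ![(\col__ _) _ _]mxE inE; case: ifP => // Aij.
  by rewrite tau_theta// Aij.
have := @mean_descent R n d A mu tt sig s (tau A mu k) x xb xs y yb ys n0 mu0 tt0
  sig0 _ _ erefl _ _ _.
under [in X in _ -> X]eq_bigr do rewrite stepE /lyapunov dual_weightS//.
rewrite /lyapunov -/tt -/sig.
have -> : (1 + tt)^-1 * (normv ((x, y).1 - xs) ^+ 2 +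
    n%:R * tt / (mu * sig) * normv ((x, y).2 - ys) ^+ 2) =
    (1 + tt)^-1 * normv (x - xs) ^+ 2 + s / sig * normv (y - ys) ^+ 2.
  by rewrite /s /=; field; rewrite !gt_eqF// addr_gt0.
apply.
- by move=> j; exact: freq_gap.
- by [].
- move=> i; apply: le_trans (primal_dual_step_le1 n0 mu0 L0 k).
  apply: ler_wpM2l.
    by rewrite ltW// mulr_gt0// divr_gt0// mulr_gt0// ?ltr0n// addr_gt0.
  by rewrite ler_pXn2r ?nnegrE ?sqrtr_ge0 ?(ltW L0)// max_row_norm_ge.
- by move=> j; rewrite [xb j 0]mxE; apply: prox_primal; exact: tau_gt0.
- by move=> i; rewrite [yb i 0]mxE; exact: prox_dual.
Qed.

End PureCDStep.

(** * Expected cost and mean convergence of the iterates *)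

Section Expectations.
Context {R : realType} {disp : measure_display} {T : measurableType disp}.
Variables (P : probability T R) (n d : nat) (A : 'M[R]_(n, d)).
Variable i_ : nat -> T -> 'I_n.
Hypotheses (n0 : (0 < n)%N) (unif : uniform_sampling P i_).

(* Beyond the first k indices the value is irrelevant. *)
Definition extend k (v : {ffun 'I_k -> 'I_n}) (l : nat) : 'I_n :=
  if insub l is Some l' then v l' else Ordinal n0.

Lemma extend_past k w l : (l < k)%N -> extend (past i_ k w) l = i_ l w.
Proof. by move=> lk; rewrite /extend insubT ffunE. Qed.

Section Cost.
Variables (c0 c1 : R).
Hypotheses (c0_ge0 : 0 <= c0) (c1_ge0 : 0 <= c1).

Lemma sum_row_supp : \sum_i #|row_supp A i|%:R = (nnz A)%:R :> R.
Proof.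
rewrite -natr_sum /nnz -sum1_card; congr _%:R.
under eq_bigr => i _ do rewrite -sum1_card.
rewrite pair_big_dep /=; apply: eq_bigl => -[i j] /=.
by rewrite inE.
Qed.

Lemma pure_cd_cost_ext (i i' : nat -> 'I_n) K :
  (forall l, (l < K)%N -> i l = i' l) ->
  pure_cd_cost A c0 c1 i K = pure_cd_cost A c0 c1 i' K.
Proof. by move=> ii'; congr (_ + _); apply: eq_bigr => l _; rewrite ii'. Qed.

Lemma pure_cd_cost_ge0 i K : 0 <= pure_cd_cost A c0 c1 i K.
Proof. by rewrite addr_ge0 ?mulr_ge0// sumr_ge0// => l _; rewrite mulr_ge0. Qed.

(** The constant [c] makes the induction go through: averaging over the last index moves its mean
    cost [c1 * nnz / n] into [c]. *)
Lemma expectation_cost K c : 0 <= c ->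
  ('E_P[fun w => (pure_cd_cost A c0 c1 (fun l => i_ l w) K + c)%R] =
   (c0 * (nnz A)%:R + K%:R * (c1 * (nnz A)%:R / n%:R) + c)%:E)%E.
Proof.
elim: K c => [|K IH] c cge0.
  rewrite (_ : (fun _ => _) = cst (c0 * (nnz A)%:R + c)).
    by rewrite expectation_cst mul0r addr0.
  by apply/funext => w; rewrite /pure_cd_cost big_ord0 addr0.
pose phi i v := pure_cd_cost A c0 c1 (@extend K v) K + c1 * #|row_supp A i|%:R + c.
rewrite (_ : (fun _ => _) = fun w => phi (i_ K w) (past i_ K w)); last first.
  apply/funext => w; rewrite /phi (@pure_cd_cost_ext _ (fun l => i_ l w)).
    by rewrite /pure_cd_cost big_ord_recr/= addrA.
  by move=> l lK; exact: extend_past.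
rewrite expectation_next// => [|i v]; last first.
  by apply: addr_ge0 => //; apply: addr_ge0; [exact: pure_cd_cost_ge0|rewrite mulr_ge0].
rewrite (_ : (fun _ => _) = fun w => pure_cd_cost A c0 c1 (fun l => i_ l w) K +
    (c1 * (nnz A)%:R / n%:R + c)); last first.
  apply/funext => w; rewrite /phi (@pure_cd_cost_ext _ (fun l => i_ l w)).
    move: (pure_cd_cost A c0 c1 (fun l => i_ l w) K) => C.
    rewrite !big_split/= !sumr_const card_ord -mulr_sumr sum_row_supp.
    rewrite -(mulr_natl C) -(mulr_natl c); field.
    by rewrite pnatr_eq0 -lt0n.
  by move=> l lK; exact: extend_past.
rewrite IH; first by congr EFin; rewrite -natr1; ring.
by rewrite addr_ge0// divr_ge0// mulr_ge0.
Qed.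

End Cost.

Lemma ge0_expectationZl (F : T -> R) (c : R) : measurable_fun setT F ->
  (forall w, 0 <= F w) -> 0 <= c ->
  ('E_P[fun w => (c * F w)%R] = c%:E * 'E_P[F])%E.
Proof.
move=> mF F0 c0; rewrite unlock.
under eq_integral do rewrite EFinM.
rewrite ge0_integralZl_EFin//; first by move=> w _; rewrite lee_fin.
exact/measurable_EFinP.
Qed.

(** Makes iterate [K] a function of the finite history, through [extend]. *)
Lemma pure_cd_ext g_ h_ tau sigma theta (x0 : 'cV[R]_d) y0 (i i' : nat -> 'I_n) K :
  (forall l, (l < K)%N -> i l = i' l) ->
  pure_cd A g_ h_ tau sigma theta x0 y0 i K =
  pure_cd A g_ h_ tau sigma theta x0 y0 i' K.
Proof.
elim: K => //= K IH ii'; rewrite ii'// IH// => l lK.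
by apply: ii'; rewrite ltnW.
Qed.

Variables (g : 'cV[R]_d -> \bar R) (g_ : 'I_d -> R -> \bar R).
Variables (hs : 'cV[R]_n -> \bar R) (h_ : 'I_n -> R -> \bar R).
Variables (mu : R) (x0 : 'cV[R]_d) (y0 : 'cV[R]_n).
Hypotheses (colA : forall j, (0 < #|col_supp A j|)%N).
Hypotheses (pg : proper_fun g) (cg : convex_ereal g).
Hypotheses (lg : lower_semicontinuous g) (sg : separable g g_).
Hypotheses (ph : proper_fun hs) (ch : convex_ereal hs).
Hypotheses (lh : lower_semicontinuous hs) (sh : separable hs h_).
Hypotheses (mu0 : 0 < mu) (scg : strongly_convex mu g).
Hypothesis L0 : 0 < max_row_norm A.

Local Notation Z i K := (pure_cd A g_ h_ (tau A mu) (fun k _ => sigma A mu k)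
  (theta A mu) x0 y0 i K).
Local Notation tt := (tau_tilde A mu).

Lemma primal_le_lyapunov xs ys K z :
  normv (z.1 - xs) ^+ 2 <= lyapunov A mu xs ys K z.
Proof.
rewrite lerDl mulr_ge0 ?sqr_ge0// divr_ge0 ?mulr_ge0// ltW//.
  exact: tau_tilde_gt0.
exact: sigma_gt0.
Qed.

Lemma lyapunov_ge0 xs ys K z : 0 <= lyapunov A mu xs ys K z.
Proof. exact: le_trans (sqr_ge0 _) (primal_le_lyapunov _ _ _ _). Qed.

(** Averaging over the last index first contracts by (1 + t_K)^-1, that is (t_(K+1) / t_K)^2, and
    the induction hypothesis gives the remaining factors. *)
Lemma expectation_lyapunov xs ys K : saddle_point A g hs xs ys ->
  ('E_P[fun w => lyapunov A mu xs ys K (Z (fun l => i_ l w) K)] <=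
   ((tt K / tt 0%N) ^+ 2 * lyapunov A mu xs ys 0 (x0, y0))%:E)%E.
Proof.
move=> sp; have t0 := tau_tilde_gt0 n0 mu0 L0.
elim: K => [|K IH].
  rewrite (_ : (fun _ => _) = cst (lyapunov A mu xs ys 0 (x0, y0)))//.
  by rewrite expectation_cst divff ?gt_eqF// expr1n mul1r.
pose step := pure_cd_step A g_ h_ (tau A mu) (fun k _ => sigma A mu k) (theta A mu).
pose ZK v := Z (@extend K v) K.
have ZKE w : ZK (past i_ K w) = Z (fun l => i_ l w) K.
  by apply: pure_cd_ext => l lK; exact: extend_past.
pose phi i v := lyapunov A mu xs ys K.+1 (step K i (ZK v)).
rewrite (_ : (fun _ => _) = fun w => phi (i_ K w) (past i_ K w)); last first.
  by apply/funext => w; rewrite /phi ZKE.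
rewrite expectation_next// => [|i v]; last exact: lyapunov_ge0.
pose psi v := lyapunov A mu xs ys K (ZK v).
have c_ge0 : 0 <= (1 + tt K)^-1 by rewrite invr_ge0 addr_ge0// ltW.
apply: (@le_trans _ _ 'E_P[fun w => ((1 + tt K)^-1 * psi (past i_ K w))%R])%E.
  apply: ge0_expectation_le => [||w].
  - exact: (measurable_past_fun unif (fun v => n%:R^-1 * \sum_i phi i v)).
  - exact: (measurable_past_fun unif (fun v => (1 + tt K)^-1 * psi v)).
  - rewrite mulr_ge0 ?invr_ge0 ?sumr_ge0//=; last by move=> i _; exact: lyapunov_ge0.
    exact: (mean_lyapunov n0 colA pg cg lg sg ph ch lh sh mu0 scg sp).
rewrite (ge0_expectationZl (measurable_past_fun unif psi) _ c_ge0); last first.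
  by move=> w; exact: lyapunov_ge0.
rewrite (_ : (fun w => psi _) = fun w => lyapunov A mu xs ys K (Z (fun l => i_ l w) K)).
  apply: (le_trans (lee_wpmul2l _ IH)); rewrite ?lee_fin//.
  by rewrite [in leRHS]expr_div_n tau_tildeS_sqr// expr_div_n !mulrA.
by apply/funext => w; rewrite /psi ZKE.
Qed.

Lemma expectation_primal xs ys K : saddle_point A g hs xs ys ->
  ('E_P[fun w => (normv ((Z (fun l => i_ l w) K).1 - xs) ^+ 2)%R] <=
   ((tt K / tt 0%N) ^+ 2 * Dstar A g hs x0 y0)%:E)%E.
Proof.
move=> sp; have t0 := tau_tilde_gt0 n0 mu0 L0.
set E := ('E_P[_])%E.
have c0 : 0 < (tt K / tt 0%N) ^+ 2 by rewrite exprn_gt0// divr_gt0.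
have E0 : (0 <= E)%E by apply: expectation_ge0 => w; rewrite sqr_ge0.
have HE xs' ys' : saddle_point A g hs xs' ys' -> (E <= ((tt K / tt 0%N) ^+ 2 *
    (normv (xs' - x0) ^+ 2 + normv (ys' - y0) ^+ 2))%:E)%E.
  move=> sp'; have -> : E = ('E_P[fun w =>
      (normv ((Z (fun l => i_ l w) K).1 - xs') ^+ 2)%R])%E.
    by rewrite /E (saddle_primal_unique pg ph mu0 scg sp sp').
  pose X v := Z (@extend K v) K.
  have XE w : Z (fun l => i_ l w) K = X (past i_ K w).
    by apply: pure_cd_ext => l lK; rewrite extend_past.
  apply: (@le_trans _ _ ('E_P[fun w => lyapunov A mu xs' ys' K (X (past i_ K w))])%E).
    under eq_fun do rewrite XE.
    apply: ge0_expectation_le => [||w].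
    - exact: (measurable_past_fun unif (fun v => normv ((X v).1 - xs') ^+ 2)).
    - exact: (measurable_past_fun unif (fun v => lyapunov A mu xs' ys' K (X v))).
    - by rewrite sqr_ge0 primal_le_lyapunov.
  under eq_fun do rewrite -XE.
  apply: (le_trans (expectation_lyapunov K sp')); rewrite lee_fin ler_pM2l//.
  have normC m (u v : 'cV[R]_m) : normv (u - v) = normv (v - u).
    congr Num.sqrt; apply: eq_bigr => i _.
    by rewrite -!expr2 -sqrrN !mxE opprB.
  rewrite normC (normC _ ys') lerD2l ler_piMl ?sqr_ge0//.
  exact: dual_weight0_le1.
(* Once real, the expectation can be divided by the factor; the quotient is a lower bound of the set
   whose infimum is [Dstar]. *)
have Ef : E \is a fin_num.
  rewrite ge0_fin_numE//; apply: le_lt_trans (HE _ _ sp) _; exact: ltry.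
rewrite -(fineK Ef) lee_fin mulrC -ler_pdivrMr//.
apply: lb_le_inf; first by exists (normv (xs - x0) ^+ 2 + normv (ys - y0) ^+ 2), xs, ys.
move=> _ [xs' [ys' [sp' ->]]]; rewrite ler_pdivrMr// mulrC -lee_fin fineK//.
exact: HE.
Qed.

End Expectations.

(** * Iteration count and expected complexity *)

Theorem theorem5p1 (R : realType) (c0 c1 : R) (hc0 : 0 <= c0) (hc1 : 0 <= c1) :
  exists2 C : R, 0 <= C &
  forall (n d : nat) (A : 'M[R]_(n, d))
    (g : 'cV[R]_d -> \bar R) (g_ : 'I_d -> R -> \bar R)
    (hs : 'cV[R]_n -> \bar R) (h_ : 'I_n -> R -> \bar R)
    (mu eps : R) (x0 : 'cV[R]_d) (y0 : 'cV[R]_n)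
    (disp : measure_display) (T : measurableType disp) (P : probability T R)
    (i_ : nat -> T -> 'I_n),
  (0 < n)%N ->
  (forall j, 0 < #|col_supp A j|)%N ->
  proper_fun g -> convex_ereal g -> lower_semicontinuous g -> separable g g_ ->
  proper_fun hs -> convex_ereal hs -> lower_semicontinuous hs -> separable hs h_ ->
  0 < mu -> strongly_convex mu g ->
  (exists xs ys, saddle_point A g hs xs ys) ->
  (g x0 < +oo)%E -> (hs y0 < +oo)%E ->
  uniform_sampling P i_ ->
  0 < eps ->
  let X (k : nat) (w : T) : 'cV[R]_d :=
    (pure_cd A g_ h_ (tau A mu) (fun k _ => sigma A mu k) (theta A mu)
       x0 y0 (fun l => i_ l w) k).1 in
  let M : R := Num.max 1 (max_row_norm A / mu) in
  let r : R := Num.sqrt (Dstar A g hs x0 y0) / Num.sqrt eps in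
  let Kmin : R := r * (3 * n%:R * M) in
  (forall xs ys, saddle_point A g hs xs ys ->
     forall K : nat, Kmin <= K%:R ->
       ('E_P[fun w => (normv (X K w - xs) ^+ 2)%R] <= eps%:E)%E) /\
  ('E_P[fun w => pure_cd_cost A c0 c1 (fun l => i_ l w) `|Num.ceil Kmin|%N]
     <= (C * ((nnz A)%:R * (1 + r * M)))%:E)%E.
Proof.
(* The 3 comes from [Kmin]: 3 n r M iterations at mean cost [c1 * nnz / n] cost
   [3 * c1 * nnz * r * M]. Rounding up adds at most one iteration. *)
exists (c0 + 3 * c1); first by rewrite addr_ge0// mulr_ge0.
move=> n d A g g_ hs h_ mu eps x0 y0 disp T P i_ n0 colA pg cg lg sg ph ch lh sh
  mu0 scg [xs0 [ys0 sp0]] _ _ unif eps0 X M r Kmin.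
have D0 : 0 <= Dstar A g hs x0 y0.
  apply: lb_le_inf.
    by exists (normv (xs0 - x0) ^+ 2 + normv (ys0 - y0) ^+ 2), xs0, ys0.
  by move=> _ [xs [ys [_ ->]]]; rewrite addr_ge0 ?sqr_ge0.
have r0 : 0 <= r by rewrite divr_ge0 ?sqrtr_ge0.
have M1 : 1 <= M by rewrite le_max lexx.
have nR : 1 <= n%:R :> R by rewrite ler1n.
split=> [xs ys sp K hK|].
  (* Without columns [max_row_norm A] is 0 and the step-size bounds do not apply, but the primal
     vectors are empty and the error is 0. *)
  have [d0|d0] := posnP d.
    rewrite (_ : (fun _ => _) = cst 0) ?expectation_cst ?lee_fin ?ltW//.
    apply/funext => w; rewrite normv_sqr big1// => -[j jd] _.
    by exfalso; move: jd; rewrite d0.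
  have /card_gt0P[i0] := colA (Ordinal d0); rewrite inE => /max_row_norm_gt0 L0.
  apply: (le_trans (expectation_primal n0 unif x0 y0 colA pg cg lg sg ph ch lh sh
    mu0 scg L0 K sp)).
  have DE : Dstar A g hs x0 y0 = r ^+ 2 * eps.
    by rewrite /r expr_div_n sqr_sqrtr// sqr_sqrtr ?(ltW eps0)// divfK// gt_eqF.
  have t0 := tau_tilde_gt0 n0 mu0 L0; have decay := tau_tilde_decay n0 mu0 L0 K.
  rewrite lee_fin DE mulrA ler_piMl ?(ltW eps0)// -exprMn exprn_ile1//.
    by rewrite mulr_ge0 ?divr_ge0 ?(ltW (t0 _)).
  (* What remains is r t_K / t_0 <= 1. As 1 / t_0 = n M, the left side is a third of [Kmin] times
     t_K, and [Kmin <= K]. *)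
  rewrite tau_tilde0_inv// -/M.
  have : Kmin * tau_tilde A mu K <= 3 by apply: le_trans decay; rewrite ler_pM2r.
  rewrite /Kmin; set t := tau_tilde A mu K; lra.
set K := `|_|%N.
rewrite (_ : (fun _ => _) = fun w => pure_cd_cost A c0 c1 (fun l => i_ l w) K + 0).
  rewrite expectation_cost// lee_fin addr0.
  have K0 : 0 <= Kmin by rewrite mulr_ge0// mulr_ge0 ?mulr_ge0//; lra.
  have KE : K%:R <= Kmin + 1.
    rewrite /K natr_absz ger0_norm ?ceil_ge0; last lra.
    by have := ceilB1_lt Kmin; rewrite intrB; lra.
  have c1N : 0 <= c1 * (nnz A)%:R / n%:R by rewrite divr_ge0// mulr_ge0.
  have := ler_wpM2r c1N KE.
  have -> : (Kmin + 1) * (c1 * (nnz A)%:R / n%:R) =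
      c1 * (nnz A)%:R * (3 * (r * M)) + c1 * (nnz A)%:R / n%:R.
    by rewrite /Kmin; field; rewrite gt_eqF//; lra.
  have : c1 * (nnz A)%:R / n%:R <= c1 * (nnz A)%:R.
    by rewrite ler_pdivrMr ?ler_peMr ?mulr_ge0//; lra.
  have : 0 <= c0 * (nnz A)%:R * (r * M) by rewrite !mulr_ge0//; lra.
  have : 0 <= c1 * (nnz A)%:R by rewrite mulr_ge0.
  lra.
by apply/funext => w; rewrite addr0.
Qed.
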